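(* Let $K$ be a compact Hausdorff space and let $J$ be an $M$-summand in $C(K)$. Then $J$ admits centers for the class of all non-empty closed bounded subsets of $J$ (that is, $\mathrm{cent}_{J}(B)\neq\emptyset$ for every non-empty closed bounded $B\subseteq J$), and for each non-empty closed bounded subset $B$ of $J$, $$\mathrm{cent}_{J}(B)=\{h\in J: N_{B}-r_{B}\le h\le n_{B}+r_{B}\text{ on }K\}.$$ Furthermore, $\mathrm{rad}_{J}(B)=r_{B}$.
   Context: All Banach spaces are real and all subspaces are norm closed. $C(K)$ is the Banach space of real-valued continuous functions on $K$ with the supremum norm. A linear projection $P$ on a Banach space $X$ is an $M$-projection if $\|x\|=\max\{\|Px\|,\|x-Px\|\}$ for every $x\in X$; a subspace $J$ of $X$ is an $M$-summand in $X$ if it is the range of an $M$-projection on $X$. For a Banach space $Y$ and a non-empty closed bounded $B\subseteq Y$, put $r(y,B)=\sup\{\|y-b\|:b\in B\}$ for $y\in Y$, $\mathrm{rad}_{Y}(B)=\inf_{y\in Y}r(y,B)$, and $\mathrm{cent}_{Y}(B)=\{y\in Y: r(y,B)=\mathrm{rad}_{Y}(B)\}$. For a non-empty closed bounded $B\subseteq C(K)$ and $t\in K$, define $m_{B}(t)=\inf\{b(t):b\in B\}$, $M_{B}(t)=\sup\{b(t):b\in B\}$, $n_{B}(t)=\liminf_{s\to t}m_{B}(s)$, $N_{B}(t)=\limsup_{s\to t}M_{B}(s)$, and $r_{B}=\frac12\sup\{N_{B}(t)-n_{B}(t):t\in K\}$. Here $\liminf_{s\to t}m_B(s)=\sup_{U}\inf_{s\in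 U}m_B(s)$ and $\limsup_{s\to t}M_B(s)=\inf_{U}\sup_{s\in U}M_B(s)$, where $U$ runs over the neighbourhoods of $t$ (the point $t$ itself being included in $U$). *)

(* Defs.v *)
From HB Require Import structures.
From mathcomp Require Import all_boot all_order all_algebra.
From mathcomp Require Import all_classical all_reals all_analysis.

From mathcomp Require Import ring.

Set Implicit Arguments.
Unset Strict Implicit.
Unset Printing Implicit Defensive.

Import Order.TTheory GRing.Theory Num.Theory.
Import numFieldNormedType.Exports.

Local Open Scope classical_set_scope.
Local Open Scope ring_scope.

(* The compactness proof is a parameter of the type (not used by the carrier)
   so that the supremum-norm structures below can be attached to it. The alias
   also keeps them apart from the topologies that the library puts on
   [continuousType]. *)
Definition cfun (R : realType) (K : topologicalType)
  (Kcpt : compact [set: K]) : Type := continuousType K R.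
Arguments cfun R {K} Kcpt.

Section cfun_lmodule.
Context (R : realType) (K : topologicalType) (Kcpt : compact [set: K]).
Local Notation CK := (cfun R Kcpt).
Implicit Types f g h : CK.

HB.instance Definition _ := Choice.copy CK (continuousType K R).

Definition mk_cfun (u : K -> R) (uc : continuous u) : CK :=
  (mkcts uc : continuousType K R).

Lemma cfun_continuous f : continuous (f : K -> R).
Proof. exact: cts_fun. Qed.

Lemma cfunP f g : (f : K -> R) =1 g -> f = g.
Proof. by move=> fg; apply/(continuousEP (f : continuousType K R)). Qed.

Let add_cts f g : continuous (fun t => f t + g t).
Proof. by move=> t; apply: cvgD; exact: cfun_continuous. Qed.

Let opp_cts f : continuous (fun t => - f t).
Proof. by move=> t; apply: cvgN; exact: cfun_continuous. Qed.

Let scale_cts (a : R) f : continuous (fun t => a * f t).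
Proof. by move=> t; apply: cvgM; [exact: cvg_cst|exact: cfun_continuous]. Qed.

Let zero_cts : continuous (fun _ : K => 0 : R).
Proof. by move=> t; exact: cvg_cst. Qed.

Definition cfun_zero : CK := mk_cfun zero_cts.
Definition cfun_add f g : CK := mk_cfun (@add_cts f g).
Definition cfun_opp f : CK := mk_cfun (@opp_cts f).
Definition cfun_scale (a : R) f : CK := mk_cfun (@scale_cts a f).

Let cfun_addA : associative cfun_add.
Proof. by move=> f g h; apply: cfunP => t; exact: addrA. Qed.
Let cfun_addC : commutative cfun_add.
Proof. by move=> f g; apply: cfunP => t; exact: addrC. Qed.
Let cfun_add0 : left_id cfun_zero cfun_add.
Proof. by move=> f; apply: cfunP => t; exact: add0r. Qed.
Let cfun_addN : left_inverse cfun_zero cfun_opp cfun_add.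
Proof. by move=> f; apply: cfunP => t; exact: addNr. Qed.

HB.instance Definition _ :=
  GRing.isZmodule.Build CK cfun_addA cfun_addC cfun_add0 cfun_addN.

Let cfun_scaleA (a b : R) f :
  cfun_scale a (cfun_scale b f) = cfun_scale (a * b) f.
Proof. by apply: cfunP => t; exact: mulrA. Qed.
Let cfun_scale1 : left_id 1 cfun_scale.
Proof. by move=> f; apply: cfunP => t; exact: mul1r. Qed.
Let cfun_scaleDr : right_distributive cfun_scale +%R.
Proof. by move=> a f g; apply: cfunP => t; exact: mulrDr. Qed.
Let cfun_scaleDl f : {morph cfun_scale^~ f : a b / a + b}.
Proof. by move=> a b; apply: cfunP => t; exact: mulrDl. Qed.

HB.instance Definition _ := GRing.Zmodule_isLmodule.Build R CK
  cfun_scaleA cfun_scale1 cfun_scaleDr cfun_scaleDl.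

Lemma cfunE0 t : (0 : CK) t = 0. Proof. by []. Qed.
Lemma cfunED f g t : (f + g) t = f t + g t. Proof. by []. Qed.
Lemma cfunEN f t : (- f) t = - f t. Proof. by []. Qed.
Lemma cfunEZ (a : R) f t : (a *: f) t = a * f t. Proof. by []. Qed.

(* With the library's [sup set0 = 0], this is also right when [K] is empty,
   in which case C(K) = {0}. *)
Definition cfun_norm f : R := sup (range (fun t => `|f t|)).

Lemma cfun_norm_has_ubound f : has_ubound (range (fun t => `|f t|)).
Proof.
have ncts : continuous (fun t => `|f t|).
  by move=> t; apply: cvg_norm; exact: cfun_continuous.
have : compact (range (fun t => `|f t|)).
  apply: continuous_compact => //; exact: continuous_subspaceT.
move=> /compact_bounded [M [_ /(_ (M + 1))]].
rewrite ltrDl ltr01 => /(_ isT) hM; exists (M + 1) => _ [t _ <-].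
by apply: le_trans (ler_norm _) _; apply: hM; exists t.
Qed.

Lemma ler_cfun_norm f t : `|f t| <= cfun_norm f.
Proof. by apply: ub_le_sup; [exact: cfun_norm_has_ubound|exists t]. Qed.

Lemma cfun_norm_le f (M : R) :
  0 <= M -> (forall t, `|f t| <= M) -> cfun_norm f <= M.
Proof.
move=> M0 fM; rewrite /cfun_norm.
have [->|/set0P ne] := eqVneq (range (fun t => `|f t|)) set0.
  by rewrite sup0.
by apply: ge_sup => // _ [t _ <-].
Qed.

Lemma cfun_norm_ge0 f : 0 <= cfun_norm f.
Proof.
have [e|/set0P[_ [t _ _]]] := eqVneq (range (fun t => `|f t|)) set0.
  by rewrite /cfun_norm e sup0.
exact: le_trans (ler_cfun_norm f t).
Qed.

Let cfun_normD f g : cfun_norm (f + g) <= cfun_norm f + cfun_norm g.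
Proof.
apply: cfun_norm_le => [|t]; first by rewrite addr_ge0 ?cfun_norm_ge0.
by rewrite cfunED (le_trans (ler_normD _ _))// lerD ?ler_cfun_norm.
Qed.

Let cfun_normZ_le (a : R) f : cfun_norm (a *: f) <= `|a| * cfun_norm f.
Proof.
apply: cfun_norm_le => [|t]; first by rewrite mulr_ge0 ?cfun_norm_ge0.
by rewrite cfunEZ normrM ler_wpM2l ?ler_cfun_norm.
Qed.

Let cfun_normZ (a : R) f : cfun_norm (a *: f) = `|a| * cfun_norm f.
Proof.
apply/eqP; rewrite eq_le cfun_normZ_le/=.
have [->|a0] := eqVneq a 0; first by rewrite normr0 mul0r cfun_norm_ge0.
rewrite -ler_pdivlMl ?normr_gt0// -normfV.
by rewrite -{1}[f]scale1r -(mulVf a0) -scalerA cfun_normZ_le.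
Qed.

Let cfun_norm_eq0 f : cfun_norm f = 0 -> f = 0.
Proof.
move=> f0; apply: cfunP => t; apply/eqP.
by rewrite -normr_le0 -f0 ler_cfun_norm.
Qed.

HB.instance Definition _ := Lmodule_isNormed.Build R CK
  cfun_normD cfun_normZ cfun_norm_eq0.

Lemma cfun_normE f : `|f| = sup (range (fun t => `|f t|)).
Proof. by []. Qed.

Let cfun_complete (F : set_system CK) :
  ProperFilter F -> cauchy F -> cvg F.
Proof.
move=> FF /cauchy_ballP cF.
have cF_norm (e : R) : 0 < e -> \forall p \near (F, F), `|p.1 - p.2| < e.
  move=> e0; have := cF e e0; rewrite -ball_normE; exact.
have cvgFt t : cvg ((fun f : CK => f t) @ F).
  apply: R_complete; apply/cauchy_ballP => e e0.
  rewrite near_map2.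
  have [[A B] /= [FA FB] AB] := cF_norm e e0.
  exists (A, B) => // -[f g]/= [Af Bg].
  rewrite -ball_normE/=; apply: le_lt_trans (AB (f, g) (conj Af Bg)).
  exact: (ler_cfun_norm (f - g) t).
pose l t : R := lim ((fun f : CK => f t) @ F).
have Fl (e : R) : 0 < e -> F [set f : CK | forall t, `|l t - f t| < e].
  move=> e0; have e2 : 0 < e / 2 by rewrite divr_gt0.
  have [[A B] /= [FA FB] AB] := cF_norm _ e2.
  apply: filterS FB => f Bf t.
  have /cvgrPdist_lt/(_ _ e2) nl : (fun f : CK => f t) @ F --> l t by exact: cvgFt.
  have [g [Ag lg]] := filter_ex (filterI FA nl).
  rewrite -(subrKA (g t)) (splitr e) (le_lt_trans (ler_normD _ _))//.
  rewrite ltrD// (le_lt_trans _ (AB (g, f) (conj Ag Bf)))//.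
  exact: (ler_cfun_norm (g - f) t).
have lc : continuous l.
  move=> t; apply/cvgrPdist_lt => e e0.
  have e3 : 0 < e / 3 by rewrite divr_gt0.
  have [f lf] := filter_ex (Fl _ e3).
  have /cvgrPdist_lt/(_ _ e3) := @cfun_continuous f t.
  apply: filterS => s fts.
  have -> : l t - l s = (l t - f t) + (f t - f s) + (f s - l s).
    by rewrite !subrKA.
  have -> : e = e / 3 + e / 3 + e / 3 by field.
  rewrite (le_lt_trans (ler_normD _ _))// ltrD//; last by rewrite distrC lf.
  by rewrite (le_lt_trans (ler_normD _ _))// ltrD// lf.
apply/cvg_ex; exists (mk_cfun lc); apply/cvgrPdist_le => e e0.
apply: filterS (Fl _ e0) => f lf.
by apply: cfun_norm_le => [|t]; [exact: ltW|exact/ltW/lf].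
Qed.

HB.instance Definition _ := Uniform_isComplete.Build CK cfun_complete.

End cfun_lmodule.

Section M_summand.
Context (R : realType) (X : completeNormedModType R).

Definition M_projection (P : {linear X -> X}) : Prop :=
  (forall x, P (P x) = P x) /\
  (forall x, `|x| = Num.max `|P x| `|x - P x|).

Definition M_summand (J : set X) : Prop :=
  exists2 P : {linear X -> X}, M_projection P & range P = J.

(* An M-projection is contractive, so its range is a norm-closed subspace:
   closedness need not be imposed separately. *)
Lemma M_summand_closed (J : set X) : M_summand J -> closed J.
Proof.
move=> [P [PP Pmax] <-].
have Pc : continuous P.
  move=> x; apply/cvgrPdist_lt => e e0.
  have /cvgrPdist_lt/(_ _ e0) : id @ nbhs x --> x by exact: cvg_id.
  apply: filterS => z; apply: le_lt_trans.
  by rewrite -linearB [leRHS]Pmax le_max lexx.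
have -> : range P = (fun x => x - P x) @^-1` [set 0].
  apply/seteqP; split => [_ [x _ <-]|x] /=; first by rewrite PP subrr.
  by move/subr0_eq => xP; exists x.
apply: preimage_closed => [x _|].
  by apply: cvgB; [exact: cvg_id|exact: Pc].
exact/accessible_closed_set1/hausdorff_accessible/norm_hausdorff.
Qed.

Lemma M_summand_submod_closed (J : set X) :
  M_summand J -> submod_closed (mem J).
Proof.
move=> [P _ <-]; split; first by rewrite inE; exists 0; rewrite ?linear0.
move=> a _ _ /set_mem[x _ <-] /set_mem[y _ <-].
by rewrite inE; exists (a *: x + y); rewrite ?linearP.
Qed.

End M_summand.

Section chebyshev.
Context (R : realType) (X : completeNormedModType R).
Implicit Types (Y B : set X) (y : X).

(* [Y] is a closed subspace of [X], with the norm of [X]. *)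

Definition cheb_r y B : R := sup [set `|y - b| | b in B].

Definition cheb_rad Y B : R := inf [set cheb_r y B | y in Y].

Definition cheb_cent Y B : set X :=
  [set y | Y y /\ cheb_r y B = cheb_rad Y B].

Definition admits_centers Y (F : set (set X)) : Prop :=
  forall B, F B -> cheb_cent Y B !=set0.

(* For a closed subspace [Y], being closed in [Y] and in [X] are the same. *)
Definition nonempty_closed_bounded_subsets Y : set (set X) :=
  [set B | [/\ B !=set0, B `<=` Y, closed B & bounded_set B]].

End chebyshev.

(* [nbhs t] is the filter of neighborhoods of [t], not the punctured one. *)

Definition liminf_at (R : realType) (K : topologicalType) (u : K -> R)
  (t : K) : R := sup [set inf (u @` U) | U in nbhs t].

Definition limsup_at (R : realType) (K : topologicalType) (u : K -> R)
  (t : K) : R := inf [set sup (u @` U) | U in nbhs t].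

Lemma limsup_atE (R : realType) (K : topologicalType) (u : K -> R) (t : K) :
  (exists M, forall s, `|u s| <= M) ->
  (limsup_at u t)%:E = limf_esup (EFin \o u) (nbhs t).
Proof.
move=> [M uM]; rewrite limf_esupE /limsup_at.
have ubU U : has_ubound (u @` U).
  by exists M => _ [s _ <-]; exact: le_trans (ler_norm _) (uM s).
rewrite -ereal_inf_EFin; last 2 first.
- exists (- M) => _ [U tU <-]; apply: (@le_trans _ _ (u t)).
    by have := uM t; rewrite ler_norml => /andP[].
  by apply: ub_le_sup => //; exists t => //; exact: nbhs_singleton.
- by exists (sup (range u)), setT => //; exact: filterT.
congr ereal_inf; rewrite image_comp; apply: eq_imagel => U tU /=.
rewrite -image_comp ereal_sup_EFin//; exists (u t), t => //.
exact: nbhs_singleton.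
Qed.

Lemma liminf_atE (R : realType) (K : topologicalType) (u : K -> R) (t : K) :
  (exists M, forall s, `|u s| <= M) ->
  (liminf_at u t)%:E = limf_einf (EFin \o u) (nbhs t).
Proof.
move=> [M uM]; rewrite /limf_einf.
have -> : (\- (EFin \o u))%E = EFin \o (fun s => - u s) by [].
rewrite -limsup_atE; last by exists M => s; rewrite normrN.
rewrite -EFinN /limsup_at /inf opprK; congr (sup _)%:E.
rewrite image_comp; apply: eq_imagel => U tU /=.
by rewrite /inf; congr (- sup _); rewrite image_comp.
Qed.

Section envelopes.
Context (R : realType) (K : topologicalType) (Kcpt : compact [set: K]).
Implicit Types (B : set (cfun R Kcpt)) (t : K).

Definition lower_m B t : R := inf [set b t | b in B].

Definition upper_M B t : R := sup [set b t | b in B].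

Definition lower_n B t : R := liminf_at (lower_m B) t.

Definition upper_N B t : R := limsup_at (upper_M B) t.

Definition radius_r B : R :=
  2^-1 * sup (range (fun t => upper_N B t - lower_n B t)).

End envelopes.

(* Main.v *)
(* For f in C(K) and rho >= 0, all of B lies within rho of f iff
   N_B - rho <= f <= n_B + rho; in particular rho >= r_B. As N_B - r_B is upper
   and n_B + r_B lower semicontinuous, the Katetov-Tong theorem inserts a
   continuous f between them. Since the M-projection P onto J is contractive
   and fixes B, P f lies in J and is no farther from B than f is. *)
Require Import Defs.
From HB Require Import structures.
From mathcomp Require Import all_boot all_order all_algebra.
From mathcomp Require Import all_classical all_reals all_analysis.
From mathcomp Require Import lra.

Set Implicit Arguments.
Unset Strict Implicit.
Unset Printing Implicit Defensive.

Import Order.TTheory GRing.Theory Num.Theory.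
Import numFieldNormedType.Exports.

Local Open Scope classical_set_scope.
Local Open Scope ring_scope.

(** * Semicontinuity and the regularizations [limsup_at], [liminf_at] *)

Definition usc (R : realType) (K : topologicalType) (u : K -> R) : Prop :=
  forall t a, u t < a -> \forall s \near t, u s < a.

Definition lsc (R : realType) (K : topologicalType) (u : K -> R) : Prop :=
  forall t a, a < u t -> \forall s \near t, a < u s.

Section semicontinuity.
Context (R : realType) (K : topologicalType).
Implicit Types (u f : K -> R) (a : R).

Lemma uscN u : lsc u -> usc (fun t => - u t).
Proof.
move=> lu t a ua; have : - a < u t by rewrite ltrNl.
by move/lu; apply: filterS => s; rewrite ltrNl.
Qed.

Lemma lscN u : usc u -> lsc (fun t => - u t).
Proof.
move=> uu t a ua; have : u t < - a by rewrite ltrNr.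
by move/uu; apply: filterS => s; rewrite ltrNr.
Qed.

Lemma uscB u f : usc u -> continuous f -> usc (fun t => u t - f t).
Proof.
move=> uu fc t a uta; pose e := (a - (u t - f t)) / 2.
have e0 : 0 < e by rewrite divr_gt0// subr_gt0.
have /uu ue : u t < u t + e by rewrite ltrDl.
have /cvgrPdist_lt/(_ _ e0) fe := fc t.
apply: filterS2 ue fe => s us /ltr_distlDr; rewrite /e in us *; lra.
Qed.

Lemma lscB u f : lsc u -> continuous f -> lsc (fun t => u t - f t).
Proof.
move=> lu fc; have fNc : continuous (fun t => - f t).
  by move=> t; apply: cvgN; exact: fc.
have := lscN (uscB (uscN lu) fNc).
by congr lsc; apply/funext => t; rewrite opprB opprK addrC.
Qed.

Lemma closed_usc_ge u a : usc u -> closed [set t | a <= u t].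
Proof.
move=> uu; rewrite -openC openE => t /= /negP; rewrite -ltNge => /uu.
by apply: filterS => s; rewrite ltNge => /negP.
Qed.

Lemma closed_lsc_le u a : lsc u -> closed [set t | u t <= a].
Proof.
move=> lu; rewrite -openC openE => t /= /negP; rewrite -ltNge => /lu.
by apply: filterS => s; rewrite ltNge => /negP.
Qed.

(** A neighborhood [U] of [t] on which the supremum of [u] is below [a] is also a neighborhood of
    every point of its interior, so it bounds [limsup_at u] there too. *)
Lemma limsup_at_usc u M : (forall t, `|u t| <= M) -> usc (limsup_at u).
Proof.
move=> uM t a /inf_lt[|_ [U tU <-] Ua].
  by exists (sup (range u)), setT => //; exact: filterT.
have /filterS := nbhs_interior tU; apply => s Us.
apply: le_lt_trans Ua; apply: ge_inf; last by exists U.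
(* The infimum is meaningful only for a family bounded below: a supremum over a neighborhood of [s]
   is at least [u s], hence at least [- M]. *)
exists (- M) => _ [V sV <-]; apply: (@le_trans _ _ (u s)).
  by have := uM s; rewrite ler_norml => /andP[].
apply: ub_le_sup; last by exists s => //; exact: nbhs_singleton.
by exists M => _ [x _ <-]; exact: le_trans (ler_norm _) (uM x).
Qed.

Lemma liminf_atN u t : liminf_at u t = - limsup_at (fun s => - u s) t.
Proof.
rewrite /liminf_at /limsup_at /inf opprK image_comp.
congr sup; apply: eq_imagel => U _ /=; congr (- sup _).
by rewrite image_comp.
Qed.

Lemma liminf_at_lsc u M : (forall t, `|u t| <= M) -> lsc (liminf_at u).
Proof.
move=> uM; rewrite (_ : liminf_at u = fun t => - limsup_at (fun s => - u s) t).
  by apply/lscN/(@limsup_at_usc _ M) => t; rewrite normrN.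
by apply/funext => t; rewrite liminf_atN.
Qed.

Lemma limsup_at_ge u M t : (forall s, `|u s| <= M) -> u t <= limsup_at u t.
Proof.
move=> uM; apply: lb_le_inf.
  by exists (sup (range u)), setT => //; exact: filterT.
move=> _ [U tU <-]; apply: ub_le_sup; last first.
  by exists t => //; exact: nbhs_singleton.
by exists M => _ [x _ <-]; exact: le_trans (ler_norm _) (uM x).
Qed.

(** On the neighborhood of [t] where [f] stays within [e] of [f t], the supremum of [u] is at most
    [f t + e]. This carries pointwise bounds by continuous functions over to the envelopes. *)
Lemma limsup_at_le u f M t : (forall s, `|u s| <= M) -> continuous f ->
  (forall s, u s <= f s) -> limsup_at u t <= f t.
Proof.
move=> uM fc uf; apply/ler_addgt0Pr => e e0.
have /cvgrPdist_lt/(_ _ e0) fe := fc t.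
apply: (@le_trans _ _ (sup (u @` [set s | `|f t - f s| < e]))).
  apply: ge_inf; last by exists [set s | `|f t - f s| < e].
  exists (- M) => _ [V sV <-]; apply: (@le_trans _ _ (u t)).
    by have := uM t; rewrite ler_norml => /andP[].
  apply: ub_le_sup; last by exists t => //; exact: nbhs_singleton.
  by exists M => _ [x _ <-]; exact: le_trans (ler_norm _) (uM x).
apply: ge_sup; first by exists (u t), t => //=; rewrite subrr normr0.
move=> _ [s /= /ltr_distlCDr fts <-]; apply: le_trans (uf s) _.
exact: ltW.
Qed.

Lemma liminf_at_le u M t : (forall s, `|u s| <= M) -> liminf_at u t <= u t.
Proof.
move=> uM; rewrite liminf_atN lerNl.
by apply: (@limsup_at_ge _ M) => s; rewrite normrN.
Qed.

Lemma liminf_at_ge u f M t : (forall s, `|u s| <= M) -> continuous f ->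
  (forall s, f s <= u s) -> f t <= liminf_at u t.
Proof.
move=> uM fc fu; rewrite liminf_atN lerNr.
apply: (@limsup_at_le _ (fun s => - f s) M) => [s|s|s].
- by rewrite normrN.
- by apply: cvgN; exact: fc.
- by rewrite lerN2.
Qed.

End semicontinuity.

(** * Insertion of a continuous function between semicontinuous ones *)

Section insertion.
Context (R : realType) (K : topologicalType) (Kcpt : compact [set: K]).
Hypothesis Khaus : hausdorff_space K.
Variables g h : K -> R.
Hypotheses (g_usc : usc g) (h_lsc : lsc h) (gh : forall t, g t <= h t).
Local Notation CK := (cfun R Kcpt).

(** The set where [f] exceeds [h] by at least [c/3] and the set where it falls short of [g] by at
    least [c/3] are closed by semicontinuity and disjoint by [gh]. A Urysohn function equal to
    [-c/3] on the first and [c/3] on the second, with values in between, is the correction: it moves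
    [f] the right way where the error is large, and elsewhere adds at most [c/3] to an error below
    [c/3]. *)
Lemma semicontinuous_insertion_step (c : R) (f : CK) : 0 < c ->
  (forall t, g t - c <= f t <= h t + c) ->
  exists f' : CK, (forall t, g t - 2/3 * c <= f' t <= h t + 2/3 * c) /\
    `|f' - f| <= 1/3 * c.
Proof.
move=> c0 fc; have ctsf : continuous f by exact: cfun_continuous.
have [||||u [uc uL uR urng]] := @urysohn_ext_itv K R (compact_normal Khaus Kcpt)
    [set t | h t - f t <= - (1/3 * c)] [set t | 1/3 * c <= g t - f t]
    (- (1/3 * c)) (1/3 * c).
- exact/closed_lsc_le/lscB.
- exact/closed_usc_ge/uscB.
- by rewrite -subset0 => t [/= ? ?]; have := gh t; lra.
- by lra.
have ub t : - (1/3 * c) <= u t <= 1/3 * c.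
  by have /= := urng (u t) (ex_intro2 _ _ t I erefl); rewrite in_itv.
exists (f + mk_cfun Kcpt uc); split=> [t|].
  rewrite cfunED -[mk_cfun _ _ t]/(u t).
  have /andP[? ?] := fc t; have /andP[? ?] := ub t.
  have := gh t; have [hf|?] := leP (h t - f t) (- (1/3 * c)).
    have -> : u t = - (1/3 * c) by apply: uL; exists t.
    by move=> ?; apply/andP; split; lra.
  have [gf|?] := leP (1/3 * c) (g t - f t).
    have -> : u t = 1/3 * c by apply: uR; exists t.
    by move=> ?; apply/andP; split; lra.
  by move=> _; apply/andP; split; lra.
rewrite addrAC subrr add0r; apply: cfun_norm_le => [|t]; first by lra.
by rewrite ler_norml; exact: ub.
Qed.

(* Katetov-Tong, by the iteration that proves Tietze's theorem: the error in
   [g <= f <= h] shrinks by a factor 2/3 at each step. *)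
Lemma semicontinuous_insertion (c : R) : (forall t, g t <= c /\ - c <= h t) ->
  exists f : CK, forall t, g t <= f t <= h t.
Proof.
(* This [d] is positive and makes the zero function an admissible start: [g - d <= 0 <= h + d]. *)
move=> ghc; pose d : R := `|c| + 1; have d0 : 0 < d by rewrite ltr_wpDl.
pose e n : R := geometric d (2/3) n.
have e0 n : 0 < e n by rewrite mulr_gt0// exprn_gt0// divr_gt0.
pose near n (f : CK) := forall t, g t - e n <= f t <= h t + e n.
(* The implication sits under the existential so that [choice] yields a map on all of [CK]; where
   [near n f] fails, [f] itself serves. *)
have step n f : exists f', near n f ->
    near n.+1 f' /\ `|f' - f| <= 1/3 * e n.
  have [/(semicontinuous_insertion_step (e0 n))[f' [f'h f'f]]|?] :=
    pselect (near n f).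
    by exists f' => _; split=> // t; rewrite /e /= exprS mulrCA; exact: f'h.
  by exists f.
pose F n := projT1 (choice (step n)).
have FP n f : near n f -> near n.+1 (F n f) /\ `|F n f - f| <= 1/3 * e n.
  exact: (projT2 (choice (step n))).
pose f_ := fix f_ n : CK := if n is n'.+1 then F n' (f_ n') else 0.
have f_near n : near n (f_ n).
  elim: n => [t|n /FP[]//]; rewrite cfunE0 /e /= expr0 mulr1 /d.
  have [? ?] := ghc t; have ? := ler_norm c.
  by apply/andP; split; lra.
(* The increments are dominated by a geometric series of ratio [2/3], so they sum in the complete
   space [CK]; since [f_ 0 = 0], the partial sums are the [f_ n]. *)
pose u_ n : CK := f_ n.+1 - f_ n.
have z1 : `|2/3 : R| < 1 by rewrite ger0_norm; lra.
have u_cvg : cvgn (series u_).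
  apply: normed_cvg.
  apply: (series_le_cvg _ _ _ (is_cvg_geometric_series (a := 1/3 * d) z1)).
  - by move=> n; exact: normr_ge0.
  - by move=> n; rewrite /= mulr_ge0 ?exprn_ge0 ?mulr_ge0 ?ltW// divr_gt0.
  - by move=> n; rewrite /= -(mulrA (1/3) d); exact: (FP n _ (f_near n)).2.
have f_E n : f_ n = series u_ n.
  by rewrite /series /= /u_ telescope_sumr// subr0.
have f_cvg : f_ @ \oo --> limn (series u_).
  by rewrite (_ : f_ = series u_) //; apply/funext.
exists (limn (series u_)) => t; set f := limn _ in f_cvg *.
(* A single index controls both the distance to the limit and the insertion error, each later taken
   below [a / 2]. *)
have close (a : R) : 0 < a -> exists n, `|f - f_ n| < a /\ e n < a.
  move=> a0; have /cvgrPdist_lt/(_ _ a0) A := f_cvg.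
  have /cvgrPdist_lt/(_ _ a0) B : e @ \oo --> (0 : R) by exact: cvg_geometric.
  have [n [An Bn]] := filter_ex (filterI A B); exists n; split => //.
  by move: Bn; rewrite /= sub0r normrN gtr0_norm.
apply/andP; split; apply/ler_addgt0Pr => a a0;
  have a2 : 0 < a / 2 by [rewrite divr_gt0];
  have [n [fn en]] := close _ a2; have /andP[] := f_near n t;
  have := le_lt_trans (ler_cfun_norm (f - f_ n) t) fn;
  by rewrite cfunED cfunEN ltr_norml => /andP[? ?] ? ?; lra.
Qed.

End insertion.

(** * Distance to a bounded set of functions, in terms of its envelopes *)

Section chebyshev_radius.
Context (R : realType) (K : topologicalType) (Kcpt : compact [set: K]).
Local Notation CK := (cfun R Kcpt).
Variables (B : set CK) (M : R).
Hypotheses (B0 : B !=set0) (BM : forall b, B b -> `|b| <= M).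

Lemma ball_eval b t : B b -> - M <= b t <= M.
Proof.
by move=> /BM bM; rewrite -ler_norml; exact: le_trans (ler_cfun_norm b t) bM.
Qed.

Lemma upper_M_ge b t : B b -> b t <= upper_M B t.
Proof.
move=> Bb; apply: ub_le_sup; last by exists b.
by exists M => _ [a /(ball_eval t)/andP[_ ?] <-].
Qed.

Lemma upper_M_le t x : (forall b, B b -> b t <= x) -> upper_M B t <= x.
Proof.
move=> Bx; apply: ge_sup; first by have [b Bb] := B0; exists (b t), b.
by move=> _ [b /Bx ? <-].
Qed.

Lemma lower_m_le b t : B b -> lower_m B t <= b t.
Proof.
move=> Bb; apply: ge_inf; last by exists b.
by exists (- M) => _ [a /(ball_eval t)/andP[? _] <-].
Qed.

Lemma lower_m_ge t x : (forall b, B b -> x <= b t) -> x <= lower_m B t.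
Proof.
move=> Bx; apply: lb_le_inf; first by have [b Bb] := B0; exists (b t), b.
by move=> _ [b /Bx ? <-].
Qed.

Lemma upper_M_bound t : `|upper_M B t| <= M.
Proof.
have [b Bb] := B0; rewrite ler_norml; apply/andP; split.
  by apply: le_trans (upper_M_ge t Bb); case/andP: (ball_eval t Bb).
by apply: upper_M_le => a /(ball_eval t)/andP[].
Qed.

Lemma lower_m_bound t : `|lower_m B t| <= M.
Proof.
have [b Bb] := B0; rewrite ler_norml; apply/andP; split.
  by apply: lower_m_ge => a /(ball_eval t)/andP[].
by apply: le_trans (lower_m_le t Bb) _; case/andP: (ball_eval t Bb).
Qed.

Lemma upper_N_ge b t : B b -> b t <= upper_N B t.
Proof.
move=> Bb; apply: le_trans (upper_M_ge t Bb) _.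
exact/limsup_at_ge/upper_M_bound.
Qed.

Lemma lower_n_le b t : B b -> lower_n B t <= b t.
Proof.
move=> Bb; apply: le_trans (lower_m_le t Bb).
exact/liminf_at_le/lower_m_bound.
Qed.

Lemma upper_N_le f t : continuous f ->
  (forall b s, B b -> b s <= f s) -> upper_N B t <= f t.
Proof.
move=> fc Bf; apply: (limsup_at_le _ upper_M_bound fc) => s.
by apply: upper_M_le => b; exact: Bf.
Qed.

Lemma lower_n_ge f t : continuous f ->
  (forall b s, B b -> f s <= b s) -> f t <= lower_n B t.
Proof.
move=> fc Bf; apply: (liminf_at_ge _ lower_m_bound fc) => s.
by apply: lower_m_ge => b; exact: Bf.
Qed.

Lemma cheb_r_ge (f b : CK) : B b -> `|f - b| <= cheb_r f B.
Proof.
move=> Bb; apply: ub_le_sup; last by exists b.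
exists (`|f| + M) => _ [a /BM aM <-].
by rewrite (le_trans (ler_normB _ _))// lerD2l.
Qed.

Lemma cheb_r_ge0 (f : CK) : 0 <= cheb_r f B.
Proof. by have [b /(cheb_r_ge f)] := B0; exact: le_trans. Qed.

Lemma cheb_r_le (f : CK) (rho : R) :
  (forall b, B b -> `|f - b| <= rho) -> cheb_r f B <= rho.
Proof.
move=> Brho; apply: ge_sup; last by move=> _ [b /Brho ? <-].
by have [b Bb] := B0; exists `|f - b|, b.
Qed.

(** The distance bound says [b <= f + rho] and [f - rho <= b] for all [b] in [B]; as [f + rho] and
    [f - rho] are continuous, these pass to the envelopes. Conversely each [b] lies between
    [lower_n B] and [upper_N B]. The sign of [rho] covers empty [K], where the right side is vacuous
    and the norm is 0. *)
Lemma cheb_r_leP (f : CK) (rho : R) : 0 <= rho ->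
  cheb_r f B <= rho <->
  forall t, upper_N B t - rho <= f t <= lower_n B t + rho.
Proof.
move=> rho0; split=> [frho t|frho].
  have fB b s : B b -> - rho <= f s - b s <= rho.
    move=> Bb; rewrite -ler_norml; apply: le_trans (ler_cfun_norm (f - b) s) _.
    exact: le_trans (cheb_r_ge f Bb) frho.
  have ctsf : continuous f by exact: cfun_continuous.
  apply/andP; split.
    rewrite lerBlDr; apply: (@upper_N_le (fun s => f s + rho)) => [s|b s /(fB _ s)]; last lra.
    by apply: cvgD; [exact: ctsf|exact: cvg_cst].
  rewrite -lerBlDr; apply: (@lower_n_ge (fun s => f s - rho)) => [s|b s /(fB _ s)]; last lra.
  by apply: cvgB; [exact: ctsf|exact: cvg_cst].
apply: cheb_r_le => b Bb; apply: cfun_norm_le => // t.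
rewrite cfunED cfunEN ler_norml.
have := upper_N_ge t Bb; have := lower_n_le t Bb; have := frho t; lra.
Qed.

Lemma upper_N_le_bound t : upper_N B t <= M.
Proof.
apply: (@upper_N_le (fun=> M)) => [x|b x /(ball_eval x)/andP[]//].
exact: cvg_cst.
Qed.

Lemma lower_n_ge_bound t : - M <= lower_n B t.
Proof.
apply: (@lower_n_ge (fun=> - M)) => [x|b x /(ball_eval x)/andP[]//].
exact: cvg_cst.
Qed.

Lemma radius_r_ge t : upper_N B t - lower_n B t <= 2 * radius_r B.
Proof.
rewrite mulVKf//; apply: ub_le_sup; last by exists t.
exists (M + M) => _ [s _ <-].
by have := upper_N_le_bound s; have := lower_n_ge_bound s; lra.
Qed.

Lemma radius_r_le (rho : R) : 0 <= rho ->
  (forall t, upper_N B t - lower_n B t <= 2 * rho) -> radius_r B <= rho.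
Proof.
move=> rho0 Brho; rewrite /radius_r ler_pdivrMl//.
(* For empty [K] the supremum takes its default value 0. *)
have [->|/set0P ne] :=
    eqVneq (range (fun t => upper_N B t - lower_n B t)) set0.
  by rewrite sup0 mulr_ge0.
by apply: ge_sup => // _ [t _ <-].
Qed.

Lemma radius_r_ge0 : 0 <= radius_r B.
Proof.
rewrite mulr_ge0//.
have [->|/set0P[_ [t _ _]]] :=
    eqVneq (range (fun t => upper_N B t - lower_n B t)) set0.
  by rewrite sup0.
have [b Bb] := B0; have := radius_r_ge t; rewrite mulVKf//.
by apply: le_trans; have := upper_N_ge t Bb; have := lower_n_le t Bb; lra.
Qed.

(** With [rho] equal to [cheb_r f B], the two bounds of [cheb_r_leP] squeeze [upper_N B - rho] below
    [lower_n B + rho]. *)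
Lemma radius_r_le_cheb_r (f : CK) : radius_r B <= cheb_r f B.
Proof.
have f0 := cheb_r_ge0 f; apply: radius_r_le => // t.
by have /(_ (lexx _))/(_ t) := (cheb_r_leP f f0).1; lra.
Qed.

Lemma exists_cheb_r_le_radius_r : hausdorff_space K ->
  exists f : CK, cheb_r f B <= radius_r B.
Proof.
move=> Khaus; have ctsr : continuous (fun _ : K => radius_r B).
  by move=> t; exact: cvg_cst.
(* [lscB] subtracts, so [lower_n B + radius_r B] enters as a difference with [- radius_r B]. *)
have ctsNr : continuous (fun _ : K => - radius_r B).
  by move=> t; exact: cvg_cst.
have N_usc := uscB (limsup_at_usc upper_M_bound) ctsr.
have n_lsc := lscB (liminf_at_lsc lower_m_bound) ctsNr.
have [b Bb] := B0; have r0 := radius_r_ge0.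
have [||f fB] := semicontinuous_insertion Kcpt Khaus N_usc n_lsc _ (c := M).
- by move=> t; have := radius_r_ge t; rewrite /upper_N /lower_n; lra.
- move=> t; have := upper_N_le_bound t; have := lower_n_ge_bound t.
  by rewrite /upper_N /lower_n; lra.
by exists f; apply/cheb_r_leP => // t; have := fB t; rewrite opprK.
Qed.

End chebyshev_radius.

(** * Centers in an M-summand *)

Lemma M_projection_contractive (R : realType) (X : completeNormedModType R)
  (P : {linear X -> X}) x : M_projection P -> `|P x| <= `|x|.
Proof. by move=> [_ Pmax]; rewrite [leRHS]Pmax le_max lexx. Qed.

Theorem theorem3p3 (R : realType) (K : topologicalType)
    (Kcpt : compact [set: K]) (Khaus : hausdorff_space K)
    (J : set (cfun R Kcpt)) (JM : M_summand J) :
  admits_centers J (nonempty_closed_bounded_subsets J) /\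
  (forall B : set (cfun R Kcpt), nonempty_closed_bounded_subsets J B ->
    cheb_cent J B =
      [set h | J h /\ forall t : K,
         upper_N B t - radius_r B <= h t <= lower_n B t + radius_r B] /\
    cheb_rad J B = radius_r B).
Proof.
have bounded B : nonempty_closed_bounded_subsets J B ->
    B !=set0 /\ exists M, forall b, B b -> `|b| <= M.
  by move=> [B0 _ _ /pinfty_ex_gt0[M _ BM]]; split=> //; exists M.
have center B : nonempty_closed_bounded_subsets J B ->
    exists2 h, J h & cheb_r h B <= radius_r B.
  move=> /[dup] /bounded[B0 [M BM]] [_ BJ _ _].
  have [f fB] := exists_cheb_r_le_radius_r B0 BM Khaus.
  have [P PM PJ] := JM; exists (P f); first by rewrite -PJ; exists f.
  apply: cheb_r_le => // b Bb; apply: le_trans fB.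
  apply: le_trans (cheb_r_ge BM f Bb).
  (* Since [P] fixes [b], the difference [P f - b] is [P (f - b)], and contractivity applies. *)
  have [g _ Pg] : range P b by rewrite PJ; exact: BJ.
  have Pb : P b = b by rewrite -Pg PM.1.
  by rewrite -{1}Pb -linearB; exact: M_projection_contractive.
(* [radius_r B] bounds every [cheb_r y B] from below, and the [h] given by [center] attains it. *)
have rad B : nonempty_closed_bounded_subsets J B -> cheb_rad J B = radius_r B.
  move=> /[dup] /bounded[B0 [M BM]] /center[h Jh hB].
  have lb : lbound [set cheb_r y B | y in J] (radius_r B).
    by move=> _ [y _ <-]; exact: (radius_r_le_cheb_r B0 BM).
  apply/eqP; rewrite eq_le; apply/andP; split.
    by apply: le_trans hB; apply: ge_inf; [exists (radius_r B)|exists h].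
  by apply: lb_le_inf lb; exists (cheb_r h B), h.
(* This rewrites the equation defining a center as the inequality that [cheb_r_leP]
   characterizes. *)
have centP B h : nonempty_closed_bounded_subsets J B ->
    cheb_r h B <= radius_r B <-> cheb_r h B = cheb_rad J B.
  move=> /[dup] /bounded[B0 [M BM]] /rad ->; split=> [hB|->//].
  by apply/eqP; rewrite eq_le hB; exact: (radius_r_le_cheb_r B0 BM).
split=> [B BJ|B BJ].
  by have [h Jh /centP hB] := center B BJ; exists h; split=> //; exact: hB.
split; last exact: rad.
have [B0 [M BM]] := bounded B BJ; apply/seteqP.
by split=> h [Jh hB]; split=> //;
  [apply/(cheb_r_leP B0 BM h (radius_r_ge0 B0 BM))/centP|
   apply/centP => //; apply/(cheb_r_leP B0 BM h (radius_r_ge0 B0 BM))].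
Qed.
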